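(* Let $\overset{\leftrightarrow}{K}_3-e$ denote the digraph obtained from the bioriented triangle $\overset{\leftrightarrow}{K}_3$ by deleting one arc $e$. Then $\text{mader}_{\vec{\chi}}(\overset{\leftrightarrow}{K}_3-e)=3$.
   Context: Digraphs are finite, have a nonempty vertex set, are loopless and have no parallel arcs, but may contain anti-parallel pairs of arcs $(x,y),(y,x)$ (digons). The bioriented triangle $\overset{\leftrightarrow}{K}_3$ is the digraph on three vertices containing all six possible arcs. An acyclic $k$-coloring of $D$ is a map $c:V(D)\to\{1,\dots,k\}$ such that each color class $c^{-1}(i)$ induces an acyclic subdigraph (one with no directed cycle; a digon is a directed cycle of length 2). The dichromatic number $\vec{\chi}(D)$ is the smallest $k\in\mathbb{N}$ for which $D$ has an acyclic $k$-coloring. A subdivision of a digraph $F$ is any digraph obtained by replacing every arc $(x,y)$ of $F$ by a directed path from $x$ to $y$ (of length at least 1), where the subdivision paths of different arcs are internally vertex-disjoint (and their internal vertices are new vertices). A digraph $D$ contains a subdivision of $F$ if some subdigraph of $D$ is isomorphic to a subdivision of $F$. $\text{mader}_{\vec{\chi}}(F)$ denotes the smallest integer $k\ge 1$ such that every digraph $D$ with $\vec{\chi}(D)\ge k$ contains a subdivision of $F$ (it is known that such a $k$ exists for every digraph $F$). *)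

(* Defs.v *)
From mathcomp Require Import all_boot boolp.

Set Implicit Arguments.
Unset Strict Implicit.
Unset Printing Implicit Defensive.

(** * Digraphs *)

Record digraph := Digraph {
  vertex :> finType;
  is_arc : rel vertex;
  arc_irrefl : irreflexive is_arc;
  vertex_gt0 : 0 < #|vertex|
}.

Definition arc_of (D : digraph) := {a : D * D | is_arc a.1 a.2}.

Definition arc_tail (D : digraph) (a : arc_of D) : D := (val a).1.
Definition arc_head (D : digraph) (a : arc_of D) : D := (val a).2.

Definition isomorphic (D E : digraph) : Prop :=
  exists f : D -> E,
    bijective f /\ forall u v, is_arc (f u) (f v) = is_arc u v.

(** [arc_in] is only relevant on [verts]: the two fields determine the
    subdigraph with vertex set [verts] and arcs the pairs of elements of
    [verts] related by [arc_in]. *)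
Record subdigraph (D : digraph) := Subdigraph {
  verts : {set D};
  arc_in : rel D;
  verts_gt0 : 0 < #|verts|;
  sub_arc_in : {in verts &, subrel arc_in (@is_arc D)}
}.

Section SubdigraphDigraph.
Variables (D : digraph) (H : subdigraph D).

Definition sub_vertex : finType := {x : D | x \in verts H}.

Definition sub_arc : rel sub_vertex := fun u v => arc_in H (val u) (val v).

Fact sub_arc_irrefl : irreflexive sub_arc.
Proof.
move=> u; apply/negP => Auu.
by have := sub_arc_in (valP u) (valP u) Auu; rewrite arc_irrefl.
Qed.

Fact sub_vertex_gt0 : 0 < #|sub_vertex|.
Proof. by rewrite card_sig; exact: verts_gt0. Qed.

Definition digraph_of := Digraph sub_arc_irrefl sub_vertex_gt0.

End SubdigraphDigraph.

Section DelArc.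
Variables (D : digraph) (e : arc_of D).

Definition del_arc_rel : rel D :=
  fun u v => is_arc u v && ((u, v) != val e).

Fact del_arc_irrefl : irreflexive del_arc_rel.
Proof. by move=> u; rewrite /del_arc_rel arc_irrefl. Qed.

Definition del_arc := Digraph del_arc_irrefl (vertex_gt0 D).

End DelArc.

Fact biK3_irrefl : irreflexive (fun u v : 'I_3 => u != v).
Proof. by move=> u; rewrite eqxx. Qed.

Fact biK3_gt0 : 0 < #|{: 'I_3}|.
Proof. by rewrite card_ord. Qed.

Definition biK3 := Digraph biK3_irrefl biK3_gt0.

(** * Dichromatic number *)

(** As arcs are irreflexive, a nonempty [ucycle] has length at least 2; a
    digon is a [ucycle] of length 2. *)
Definition acyclic_set (D : digraph) (A : {set D}) : Prop :=
  ~ exists s : seq D, [/\ s != [::], ucycle (@is_arc D) s & {subset s <= A}].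

Definition acyclic_coloring (D : digraph) (k : nat) (c : D -> 'I_k) : Prop :=
  forall i : 'I_k, acyclic_set [set x | c x == i].

Definition acyclic_colorable (D : digraph) (k : nat) : Prop :=
  exists c : D -> 'I_k, acyclic_coloring c.

Fact acyclic_colorable_ex (D : digraph) :
  exists k, `[< acyclic_colorable D k >].
Proof.
exists #|D|; apply/asboolP; exists enum_rank => i [[|x s] []] // _.
case/andP=> cyc _ sub; have xi := sub x (mem_head _ _).
have nx : next (x :: s) x = x.
  have := sub (next (x :: s) x); rewrite mem_next mem_head => /(_ isT).
  by move: xi; rewrite !inE => /eqP <- /eqP /enum_rank_inj.
by have := next_cycle cyc (mem_head x s); rewrite nx arc_irrefl.
Qed.

Definition dichromatic_number (D : digraph) : nat :=
  ex_minn (acyclic_colorable_ex D).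

(** * Subdivisions *)

Section Subdivision.
Variables (F : digraph) (l : arc_of F -> nat).

(** The arc [a] is replaced by a path with [l a] new internal vertices, i.e.
    of length [(l a).+1]; the pair of [a] and [i < l a] is the [i]-th of
    these. *)
Definition subdiv_vertex : finType := (F + {a : arc_of F & 'I_(l a)})%type.

(** The vertex at position [i] of the path replacing [a]: [arc_tail a] for
    [i = 0], [arc_head a] for [i = (l a).+1]. *)
Definition subdiv_path (a : arc_of F) (i : nat) : subdiv_vertex :=
  if i is j.+1 then
    if (insub j : option 'I_(l a)) is Some k then
      inr (Tagged (fun a => 'I_(l a)) k)
    else inl (arc_head a)
  else inl (arc_tail a).

Definition subdiv_arc : rel subdiv_vertex := fun u v =>
  [exists a : arc_of F, exists i : 'I_(l a).+1,
    (u == subdiv_path a i) && (v == subdiv_path a i.+1)].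

Fact subdiv_arc_irrefl : irreflexive subdiv_arc.
Proof.
move=> u; apply/existsP => [[a /existsP[[i lt_i] /= /andP[/eqP-> /eqP]]]].
case: i lt_i => [|i] lt_i /=.
  case: insubP => // _ [] ht; have := valP a.
  by rewrite -/(arc_tail a) -/(arc_head a) ht arc_irrefl.
case: insubP => [k _ k_i|/negP//].
case: insubP => // k' _ k'_i [] /eqP.
rewrite -tag_eqE /tag_eq eqxx /= tagged_asE => /eqP kk'.
by move: k'_i; rewrite -kk' k_i => /n_Sn.
Qed.

Fact subdiv_vertex_gt0 : 0 < #|subdiv_vertex|.
Proof. by rewrite card_sum addn_gt0 vertex_gt0. Qed.

Definition subdivision := Digraph subdiv_arc_irrefl subdiv_vertex_gt0.

End Subdivision.

Definition contains_subdivision (D F : digraph) : Prop :=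
  exists (l : arc_of F -> nat) (H : subdigraph D),
    isomorphic (digraph_of H) (subdivision l).

(** * Mader numbers *)

Definition forces_subdivision (F : digraph) (k : nat) : Prop :=
  forall D : digraph, k <= dichromatic_number D -> contains_subdivision D F.

(** "[k] is the Mader number of [F]"; a relation, so that the existence of the
    minimum is part of the assertion. *)
Definition is_mader (F : digraph) (k : nat) : Prop :=
  [/\ 0 < k, forces_subdivision F k
    & forall j, 0 < j -> forces_subdivision F j -> k <= j].

(* Main.v *)
(** Let [S] be a minimal vertex set that is not 2-colorable; it is strong. Let
    [K] be a maximal strong proper subset of [S]. A shortest ear of [K] makes
    [K] larger and strong, so it covers [S]; if it had two or more internal
    vertices, coloring them alternately would extend a 2-coloring of [K] to
    [S], because every cycle not inside [K] uses a forward arc of the ear. So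
    [S \ K] is a single vertex [v]. By minimality, a 2-coloring of [S \ v]
    gives a cycle through [v] in each color, and these two cycles only meet in
    [v]. As [S \ v] is strong, it contains a path from the second cycle to the
    first; together they form the required subdivision. The digon shows that 3
    cannot be improved. *)

Require Import Defs.
From mathcomp Require Import all_boot.
From mathcomp Require Import boolp zify.

Set Implicit Arguments.
Unset Strict Implicit.
Unset Printing Implicit Defensive.

(** * Critical sets, strong sets and ears *)

Section Digraph.
Variable D : digraph.
Implicit Types (S K A B : {set D}) (c : D -> bool).

Definition arc_within A : rel D :=
  fun u v => [&& u \in A, v \in A & is_arc u v].

Definition strong A := [forall x in A, forall y in A, connect (arc_within A) x y].

Definition mono_cycle S c b (s : seq D) :=
  [/\ s != [::], ucycle (@is_arc D) s, {subset s <= S} & {in s, forall x, c x = b}].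

Definition two_colorable S := exists c, forall b s, ~ mono_cycle S c b s.

Definition critical S :=
  ~ two_colorable S /\ forall A, A \proper S -> two_colorable A.

Lemma strongP A :
  reflect {in A &, forall x y, connect (arc_within A) x y} (strong A).
Proof.
apply: (iffP forall_inP) => [h x y xA yA|h x xA].
  by have /forall_inP := h x xA; apply.
by apply/forall_inP => y yA; apply: h.
Qed.

Lemma arc_withinS A B : A \subset B -> subrel (arc_within A) (arc_within B).
Proof.
by move=> /subsetP sAB u v /and3P[uA vA uv]; rewrite /arc_within !sAB.
Qed.

Lemma arc_within_connectS A B x y :
  A \subset B -> connect (arc_within A) x y -> connect (arc_within B) x y.
Proof.
move=> sAB; apply: connect_sub => {x y} x y xy.
exact/connect1/(arc_withinS sAB).
Qed.

Lemma path_within A x p :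
  path (arc_within A) x p -> path (@is_arc D) x p /\ {subset p <= A}.
Proof.
elim: p x => [|y p IH] x //= /andP[/and3P[xA yA xy] /IH[yp sp]].
by rewrite xy; split=> // z; rewrite inE => /predU1P[-> //|/sp].
Qed.

Lemma cycle_within S s :
  {subset s <= S} -> cycle (@is_arc D) s -> cycle (arc_within S) s.
Proof.
move=> sS; apply: (@sub_in_cycle _ [in S]); last exact/allP.
by move=> u v uS vS uv; rewrite /arc_within uS vS.
Qed.

Lemma mono_cycle_restr S A c c' b s :
  mono_cycle S c b s -> {subset s <= A} -> {in A, c =1 c'} ->
  mono_cycle A c' b s.
Proof.
by case=> s0 cs sS cb sA cc'; split=> // x xs; rewrite -cc' ?sA // cb.
Qed.

Lemma critical_set_exists :
  ~ two_colorable setT -> exists S, critical S.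
Proof.
move=> nT.
have [|S /minsetP[/asboolP nS mS]] :=
    @ex_minset D (fun S => `[< ~ two_colorable S >]).
  by exists setT; apply/asboolP.
exists S; split=> // A AS; apply: contrapT => nA.
have defA : A = S by apply: mS (proper_sub AS); apply/asboolP.
by move: AS; rewrite defA properxx.
Qed.

(** If [y] were unreachable from [x], the set [R] of vertices reachable from [x] and its complement
    in [S] would both be proper, hence 2-colorable. The vertices of a cycle reach each other, so
    every cycle of [S] stays on one side, and the two colorings glue to one of [S]. *)
Lemma critical_strong S : critical S -> strong S.
Proof.
case=> nS cS; apply/strongP => x y xS yS.
pose R := [set z in S | connect (arc_within S) x z].
have xR : x \in R by rewrite inE xS connect0.
case: (boolP (y \in R)) => [|yR]; first by rewrite inE => /andP[].
have RS : R \subset S by apply/subsetP => z; rewrite inE => /andP[].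
case: (cS R) => [|c1 h1].
  by rewrite properE RS; apply: contra yR => /subsetP; apply.
case: (cS (S :\: R)) => [|c2 h2].
  rewrite properE subsetDl; apply/negP => /subsetP/(_ x xS).
  by rewrite inE xR.
case: nS; exists (fun z => if z \in R then c1 z else c2 z) => b s mc.
have [s0 /andP[cs us] sS cb] := mc.
have cS' := connect_cycle (cycle_within sS cs).
have [/hasP[z zs zR]|/hasPn nR] := boolP (has [in R] s).
  apply: (h1 b s); apply: mono_cycle_restr mc _ _ => [w ws|w /= ->] //.
  rewrite inE sS //; move: zR; rewrite inE => /andP[_ xz].
  exact: connect_trans xz (cS' _ _ _ _).
apply: (h2 b s); apply: mono_cycle_restr mc _ _ => [w ws|w].
  by rewrite inE sS // andbT; exact: nR.
by rewrite inE => /andP[/negbTE->].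
Qed.

(** Here [d x] is the length of a shortest path from [x] to [K] inside [S]. Shortest ears are later
    followed by descending along [d]. *)
Lemma distance_exists S K :
  (forall x, x \in S -> exists2 k, k \in K & connect (arc_within S) x k) ->
  exists d : D -> nat,
  [/\ {in S, forall x, (d x == 0) = (x \in K)},
      {in S &, forall x y, is_arc x y -> d x <= (d y).+1} &
      {in S, forall x, 0 < d x -> exists y, [/\ y \in S, is_arc x y & d x = (d y).+1]}].
Proof.
move=> toK.
pose Q x n :=
  exists p, [/\ path (arc_within S) x p, last x p \in K & size p = n].
have /boolp.choice[d dP] :
    forall x, exists n, x \in S -> Q x n /\ forall m, Q x m -> n <= m.
  move=> x; case: (boolP (x \in S)) => [xS|]; last by exists 0.
  have exQ : exists n, `[< Q x n >].
    have [k kK /connectP[p xp def_k]] := toK x xS.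
    by exists (size p); apply/asboolP; exists p; rewrite -def_k.
  case: (ex_minnP exQ) => n /asboolP Qn min_n; exists n => _; split=> // m Qm.
  exact/min_n/asboolP.
exists d; split=> [x xS|x y xS yS xy|x xS d_gt0].
- have [[p [xp lp sp]] min_d] := dP x xS.
  apply/eqP/idP => [d0|xK]; first by case: p {xp} lp sp; rewrite d0.
  by apply/eqP; rewrite -leqn0; apply: min_d; exists [::].
- have [[p [yp lp sp]] _] := dP y yS; apply: (dP x xS).2.
  by exists (y :: p); split; rewrite /= ?sp // yp /arc_within xS yS xy.
- have [[[|y p] [/= xp lp sp]] min_d] := dP x xS; first by rewrite -sp in d_gt0.
  case/andP: xp => /and3P[_ yS xy] yp; exists y; split=> //.
  apply/eqP; rewrite eqn_leq; apply/andP; split.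
    have [[q [yq lq sq]] _] := dP y yS; apply: min_d.
    by exists (y :: q); split; rewrite /= ?sq // yq /arc_within xS yS xy.
  by rewrite -sp ltnS; apply: (dP y yS).2; exists p.
Qed.

(* A minimal ear leaving [K] at an arc [k x] completes [K] to a strong set,
   hence covers [S]; the distance [d] to [K] enumerates it backwards. *)
Lemma maximal_strong_ear S K (d : D -> nat) :
  strong K -> K \proper S ->
  (forall A, strong A -> K \proper A -> A \subset S -> A = S) ->
  {in S, forall x, (d x == 0) = (x \in K)} ->
  {in S, forall x, 0 < d x -> exists y, [/\ y \in S, is_arc x y & d x = (d y).+1]} ->
  forall k x, k \in K -> x \in S :\: K -> is_arc k x ->
  {in S, forall y, d y <= d x} /\
  {in S :\: K &, injective d}.
Proof.
move=> strK /andP[KS _] maxK dK dS k x kK /setDP[xS xK] kx.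
(* [f] chooses a successor one step closer to [K], so its iterates from [x] trace a shortest path to
   [K]. *)
have /boolp.choice[f fP] : forall y, exists z, y \in S -> 0 < d y ->
    [/\ z \in S, is_arc y z & d y = (d z).+1].
  move=> y; case: (boolP (y \in S)) => [yS|]; last by exists y.
  case: (posnP (d y)) => [->|dy]; first by exists y.
  by have [z ?] := dS y yS dy; exists z.
have iterP i : i <= d x -> iter i f x \in S /\ d (iter i f x) = d x - i.
  elim: i => [|i IH] lti; first by rewrite subn0.
  have [iS di] := IH (ltnW lti).
  have [] := fP _ iS; first by rewrite di subn_gt0.
  by move=> ? _ ?; split=> //=; lia.
(* Only the iterates before step [d x] are added: the one at step [d x] has distance 0 and already
   lies in [K]. *)
pose T := K :|: [set iter i f x | i : 'I_(d x)].
have TP y : y \in T -> y \in K \/ exists2 i, i < d x & y = iter i f x.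
  by rewrite inE => /orP[->|/imsetP[i _ ->]]; [left|right; exists i].
have TK y : y \in K -> y \in T by rewrite inE => ->.
have Ti i : i <= d x -> iter i f x \in T.
  rewrite leq_eqVlt => /predU1P[->|lti]; last first.
    by rewrite inE; apply/orP; right; apply/imsetP; exists (Ordinal lti).
  have [iS di] := iterP _ (leqnn (d x)).
  by apply: TK; rewrite -dK // di subnn.
have arcT i : i < d x -> arc_within T (iter i f x) (iter i.+1 f x).
  move=> lti; rewrite /arc_within !Ti ?(ltnW lti) //.
  have [iS di] := iterP _ (ltnW lti).
  by have [] := fP _ iS; rewrite ?di ?subn_gt0.
have KT : K \subset T by exact: subsetUl.
have conK y z : y \in K -> z \in K -> connect (arc_within T) y z.
  by move=> yK zK; apply: arc_within_connectS KT _; apply: (strongP _ strK).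
have fromk i : i <= d x -> connect (arc_within T) k (iter i f x).
  elim: i => [|i IH] lti.
    by apply: connect1; rewrite /arc_within TK // (Ti 0).
  exact: connect_trans (IH (ltnW lti)) (connect1 (arcT _ lti)).
(* The induction starts at the end of the ear: [j] counts the arcs left before [K]. *)
have tok j : j <= d x -> connect (arc_within T) (iter (d x - j) f x) k.
  elim: j => [|j IH] ltj.
    have [iS di] := iterP _ (leqnn (d x)).
    by rewrite subn0; apply: conK => //; rewrite -dK // di subnn.
  apply: connect_trans (IH (ltnW ltj)); apply: connect1.
  have -> : d x - j = (d x - j.+1).+1 by lia.
  by apply: arcT; lia.
have dx_gt0 : 0 < d x by rewrite lt0n dK.
have defT : T = S.
  apply: maxK.
  - have Tk y : y \in T ->
        connect (arc_within T) y k /\ connect (arc_within T) k y.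
      case/TP => [yK|[i lti ->]]; first by split; apply: conK.
      split; last by apply/fromk/ltnW.
      by rewrite -(subKn (ltnW lti)) tok // leq_subr.
    apply/strongP => y z /Tk[yk _] /Tk[_ kz]; exact: connect_trans yk kz.
  - by rewrite properE KT; apply/negP => /subsetP/(_ x (Ti 0 isT)); apply/negP.
  - apply/subsetP => y /TP[/(subsetP KS) //|[i lti ->]].
    by case: (iterP i (ltnW lti)).
(* A vertex outside [K] is the [i]-th iterate for some [i < d x], at distance [d x - i]; so the
   distance determines [i]. *)
split=> [y|y z].
  rewrite -defT => /TP[yK|[i lti ->]].
    by have := dK _ (subsetP KS _ yK); rewrite yK => /eqP->.
  by rewrite (iterP i (ltnW lti)).2 leq_subr.
rewrite -defT => /setDP[/TP[-> //|[i lti ->]] _].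
move=> /setDP[/TP[-> //|[j ltj ->]] _].
rewrite (iterP _ (ltnW lti)).2 (iterP _ (ltnW ltj)).2 => eq_d; congr (iter _ f x); move: lti ltj eq_d; clear; lia.
Qed.

(** Otherwise a 2-coloring of a maximal strong [K], extended by the parity of [d], would be one of
    [S]. On a monochromatic cycle, take [x] at largest distance. If [x] is outside [K], its
    successor is one step closer, so by parity it lies in [K]. Then [d x = 1], the predecessor lies
    in [K] too, and the ear through [x] shows that [K] is [S] without [x]. *)
Lemma critical_del_vertex_strong S :
  critical S -> exists2 v, v \in S & strong (S :\ v).
Proof.
move=> crS; have strS := critical_strong crS; have [nS cS] := crS.
have [x0 x0S] : exists x, x \in S.
  apply/set0Pn/eqP => S0; apply: nS; exists xpredT => b [|y s] [] // _ _.
  by move=> /(_ y (mem_head _ _)); rewrite S0 inE.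
(* The empty set satisfies [strong], so it is excluded explicitly; singletons show that some set
   satisfies [P]. *)
pose P K := [&& K != set0, K \proper S & strong K].
have P1 : P [set x0].
  apply/and3P; split.
  - by apply/set0Pn; exists x0; rewrite inE.
  - rewrite properE sub1set x0S; apply/negP => Sx0.
    apply: nS; exists xpredT => b [|y s] [] // _ /andP[cs _] sS _.
    have sx z : z \in y :: s -> z = x0.
      by move/sS/(subsetP Sx0); rewrite inE => /eqP.
    have := next_cycle cs (mem_head y s).
    by rewrite (sx (next _ _)) ?mem_next ?mem_head // (sx y) ?mem_head // arc_irrefl.
  - by apply/strongP => y z /set1P-> /set1P->; exact: connect0.
have [K /maxsetP[/and3P[K0 KS strK] maxK] _] := maxset_exists P1.
have {}maxK A : strong A -> K \proper A -> A \subset S -> A = S.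
  move=> strA KA AS; apply/eqP; apply: contraT => neqAS.
  move: (KA); rewrite (maxK A) ?properxx ?proper_sub //.
  rewrite /P strA properEneq neqAS AS !andbT.
  by apply: contraNneq K0 => A0; move: KA; rewrite A0 properE subset0 => /andP[].
have [c hc] := cS K KS.
have [k0 k0K] := set0Pn _ K0.
have sKS := subsetP (proper_sub KS).
have [x xS|d [d0 dle dS]] := @distance_exists S K.
  by exists k0 => //; apply: (strongP _ strS) => //; exact: sKS.
have ear := maximal_strong_ear strK KS maxK d0 dS.
apply: contrapT => nv; apply: nS.
exists (fun z => if z \in K then c z else odd (d z)) => b s mc.
have [s0 /andP[cs us] sS cb] := mc.
have [y0 y0s] : exists y, y \in s by case: (s) s0 => // y ? _; exists y; exact: mem_head.
case: (@arg_maxnP D y0 [in s] d y0s) => x /= xs max_x.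
have xS := sS x xs.
have ys : next s x \in s by rewrite mem_next.
have xy := next_cycle cs xs.
have dxy := dle _ _ xS (sS _ ys) xy.
have ws : prev s x \in s by rewrite mem_prev.
have wx := prev_cycle cs xs.
have [dx0|dx_gt0] := posnP (d x).
  apply: (hc b s); apply: mono_cycle_restr mc _ _ => [z zs|z /= ->] //.
  by rewrite -d0 ?sS // -leqn0 -dx0; exact: max_x.
have xK : x \notin K by rewrite -d0 // -lt0n.
have xSK : x \in S :\: K by rewrite inE xK.
have noloop z : is_arc z x || is_arc x z -> z <> x.
  by move=> + zx; rewrite zx arc_irrefl.
(* Since [S] is strong, a path from [K] to [x] must leave [K] by some arc; any such arc makes [d]
   injective outside [K]. *)
have [k kK [k' k'SK kk']] : exists2 k, k \in K & exists2 k', k' \in S :\: K & is_arc k k'.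
  have /connectP[p kp def_x] := strongP _ strS k0 x (sKS _ k0K) xS.
  elim: p (k0) k0K kp def_x => [|z p IH] k kK /= kp def_x.
    by rewrite def_x kK in xK.
  case/andP: kp => /and3P[_ zS kz] zp.
  case: (boolP (z \in K)) => [zK|zK]; first exact: IH zK zp def_x.
  by exists k => //; exists z => //; rewrite inE zK.
have [_ d_inj] := ear _ _ kK k'SK kk'.
(* By maximality the only alternative is a tie, which injectivity of [d] would turn into a loop at
   [x]. *)
have yltx : d x = (d (next s x)).+1.
  have := max_x _ ys; rewrite leq_eqVlt => /predU1P[eqd|]; last first.
    by move=> lt; apply/eqP; rewrite eqn_leq dxy.
  case: (noloop (next s x)); first by rewrite xy orbT.
  by apply: d_inj; rewrite // inE sS // andbT -d0 ?sS // eqd -lt0n.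
have yK : next s x \in K.
  apply: contraT => yK; have := cb _ ys; have := cb _ xs.
  by rewrite (negbTE yK) (negbTE xK) yltx /= => <-; case: odd.
have dx1 : d x = 1 by move: yK; rewrite -d0 ?sS // yltx => /eqP->.
(* The predecessor is at distance 0 or 1, and [x] is the only vertex at distance 1. *)
have wK : prev s x \in K.
  rewrite -d0 ?sS //; have := max_x _ ws; rewrite dx1.
  case dw: (d _) => [|[|//]] // _.
  case: (noloop (prev s x)); first by rewrite wx.
  apply: d_inj; rewrite ?dw // inE sS // andbT -d0 ?sS //; by rewrite dw.
(* This second ear starts at [x] itself, so no vertex of [S] is farther than 1 from [K]. *)
have [max_d _] := ear _ _ wK xSK wx.
case: nv; exists x => //; suff -> : S :\ x = K by [].
apply/setP => z; rewrite in_setD1; case: (boolP (z \in K)) => [zK|zK].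
  by rewrite (sKS _ zK) andbT; apply: contraNneq xK => <-.
apply/andP => [[zx zS]]; case/eqP: zx; apply: d_inj => //; first by rewrite inE zK.
apply/eqP; rewrite eqn_leq max_d // dx1 lt0n d0 //.
Qed.

End Digraph.

(** * Monochromatic cycles through a vertex, and paths linking two sets *)

Section Cycles.
Variable D : digraph.
Implicit Types (S X Y : {set D}) (c : D -> bool).

(** Giving [v] the color [b] cannot produce a 2-coloring of [S]. The resulting monochromatic cycle
    must use [v], as [c] is good elsewhere, so its color is [b]; it is rotated to start at [v]. *)
Lemma mono_cycle_through S v c b :
  ~ two_colorable S -> v \in S ->
  (forall b s, ~ mono_cycle (S :\ v) c b s) ->
  exists p, [/\ path (@is_arc D) v (rcons p v), uniq (v :: p), p != [::],
                {subset p <= S :\ v} & {in p, forall z, c z = b}].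
Proof.
move=> nS vS hc; apply: contrapT => np; apply: nS.
exists (fun z => if z == v then b else c z) => b' s mc.
have [s0 cyc sS cb] := mc.
case: (boolP (v \in s)) => vs; last first.
  apply: (hc b' s); apply: mono_cycle_restr mc _ _ => [z zs|z].
    by rewrite in_setD1 sS // andbT; apply: contraNneq vs => <-.
  by rewrite in_setD1 => /andP[/negbTE->].
have [i p rs] := rot_to vs.
move: (cb v vs); rewrite eqxx => bb'; subst b'.
move: cyc; rewrite -(rot_ucycle i) rs => /andP[/= vp /andP[vNp up]].
have zs z : z \in p -> z \in s.
  by move=> zp; rewrite -(mem_rot i) rs inE zp orbT.
have zv z : z \in p -> z != v by move=> zp; apply: contraNneq vNp => <-.
case: np; exists p; split=> //.
- by rewrite /= vNp.
- by apply/eqP => p0; move: vp; rewrite p0 /= arc_irrefl.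
- by move=> z zp; rewrite in_setD1 zv // sS // zs.
- by move=> z zp; have := cb z (zs z zp); rewrite (negbTE (zv z zp)).
Qed.

(** Induction on length: an inner vertex in [X] allows cutting off the end of the path, one in [Y]
    its beginning. *)
Lemma linking_path (e : rel D) X Y y p :
  [disjoint X & Y] -> y \in Y -> path e y p -> last y p \in X ->
  exists y' x' q, [/\ y' \in Y, x' \in X, path e y' (rcons q x'),
    uniq q & {in q, forall z, (z \notin X) && (z \notin Y)}].
Proof.
move=> dXY; elim: {p}(size p).+1 {-2}p (ltnSn (size p)) y => // n IH p lt_p y yY.
move=> yp lX.
case/lastP: p => [|p x] in lt_p yp lX *.
  by rewrite (disjointFr dXY lX) in yY.
rewrite last_rcons in lX; rewrite size_rcons ltnS in lt_p.
case: (boolP (has [in X :|: Y] p)) => [/hasP[z zp]|/hasPn nXY].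
  case/splitPr: zp => p1 p2 in lt_p yp *.
  rewrite size_cat /= in lt_p.
  rewrite rcons_cat cat_path /= in yp; case/and3P: yp => yp1 p1z zp2.
  rewrite /= inE => /orP[zX|zY].
    apply: (IH (rcons p1 z) _ y) => //; rewrite ?last_rcons ?size_rcons //.
      by lia.
    by rewrite rcons_path yp1.
  by apply: (IH (rcons p2 x) _ z); rewrite ?last_rcons ?size_rcons //; lia.
(* Removing repetitions adds no inner vertices. The shortened path is not empty, since its ends lie
   in disjoint sets. *)
have := last_rcons y p x; case/shortenP: yp; case/lastP => [|q x'] yq uq sub_q.
  by move=> /= def_x; rewrite -def_x (disjointFl dXY yY) in lX.
rewrite last_rcons => def_x; subst x'.
exists y, x, q; split=> //.
  by move: uq; rewrite /= rcons_uniq => /and3P[].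
move=> z zq; rewrite -negb_or -in_setU; apply: nXY.
have := sub_q z; rewrite !mem_rcons !inE zq orbT => /(_ isT) /predU1P[zx|//].
by move: uq; rewrite /= rcons_uniq -zx zq /= andbF.
Qed.

End Cycles.

(** * Subdivisions from embeddings and from path systems *)

Section Subdivisions.
Variables D F : digraph.

Lemma subdivision_embedding (l : arc_of F -> nat) (f : subdivision l -> D) :
  injective f -> {homo f : u v / is_arc u v} -> contains_subdivision D F.
Proof.
move=> inj_f homo_f.
(* Only images of arcs are kept: the subdigraph induced on the image could have further arcs and
   fail to be isomorphic. *)
pose arcH : rel D := fun u v => [exists x, exists y,
  [&& f x == u, f y == v & is_arc x y]].
have arcHE x y : arcH (f x) (f y) = is_arc x y.
  apply/idP/idP => [/existsP[x' /existsP[y' /and3P[]]]|xy].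
    by move=> /eqP/inj_f-> /eqP/inj_f->.
  by apply/existsP; exists x; apply/existsP; exists y; rewrite !eqxx.
have V0 : 0 < #|f @: [set: subdivision l]|.
  by rewrite card_imset // cardsT vertex_gt0.
have sH : {in f @: [set: subdivision l] &, subrel arcH (@is_arc D)}.
  by move=> _ _ /imsetP[x _ ->] /imsetP[y _ ->]; rewrite arcHE; apply: homo_f.
pose H := Subdigraph V0 sH.
have fH x : f x \in verts H by apply: imset_f; rewrite inE.
pose g (x : subdivision l) : digraph_of H := exist _ (f x) (fH x).
have [h gK hK] : bijective g.
  apply: inj_card_bij => [x y /(congr1 val)/inj_f //|].
  by rewrite card_sig card_imset // cardsT.
exists l, H, h; split; first by exists g.
by move=> u v; rewrite -[u in RHS]hK -[v in RHS]hK -arcHE.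
Qed.

(** [h] places the branch vertices, and [P u v] lists the inner vertices of the path for the arc
    [(u, v)]; its values on other pairs are arbitrary. *)
Lemma path_system_subdivision (h : F -> D) (P : F -> F -> seq D) :
  injective h ->
  (forall u v, is_arc u v -> path (@is_arc D) (h u) (rcons (P u v) (h v))) ->
  (forall u v, is_arc u v -> uniq (P u v)) ->
  (forall u v w, is_arc u v -> h w \notin P u v) ->
  (forall u v u' v' z, is_arc u v -> is_arc u' v' ->
     z \in P u v -> z \in P u' v' -> (u, v) = (u', v')) ->
  contains_subdivision D F.
Proof.
move=> inj_h arcsP uniqP hP disjP.
pose Q (a : arc_of F) := P (arc_tail a) (arc_head a).
pose l a := size (Q a).
pose f (x : subdivision l) : D := match x with
  | inl w => h w
  | inr k => nth (h (arc_tail (tag k))) (Q (tag k)) (tagged k) end.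
(* Positions 0 and [(l a).+1] are the two ends, so subdivision arcs become consecutive entries of
   the path in [D]. *)
have f_path a i : i <= (l a).+1 -> f (subdiv_path l a i) =
    nth (h (arc_tail a)) (h (arc_tail a) :: rcons (Q a) (h (arc_head a))) i.
  case: i => [|i] //= lti; rewrite nth_rcons; case: insubP => [k|].
    by move=> lt_i <- /=; rewrite -/(l a) ltn_ord.
  rewrite -leqNgt ltnS in lti *; move=> lei; rewrite -/(l a) ltnNge lei /=.
  by rewrite eqn_leq lti lei.
have fQ (k : {a : arc_of F & 'I_(l a)}) : f (inr k) \in Q (tag k).
  exact/mem_nth/ltn_ord.
apply: (@subdivision_embedding l f) => [[w|k] [w'|k']|x y].
- by move/inj_h=> ->.
- move=> e; have := hP _ _ w (valP (tag k')).
  by have := fQ k'; rewrite -e /= /Q => ->.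
- move=> e; have := hP _ _ w' (valP (tag k)).
  by have := fQ k; rewrite e /= /Q => ->.
- move=> e; have tt : tag k = tag k'.
    have := disjP _ _ _ _ _ (valP (tag k)) (valP (tag k')) (fQ k).
    rewrite e => /(_ (fQ k')) E; apply: val_inj.
    by case: (val (tag k)) (val (tag k')) E => ? ? [].
  case: k k' tt e => [a i] [a' i'] /= tt; subst a'.
  move/eqP; rewrite nth_uniq //; last exact: uniqP (valP a).
  by move/eqP/val_inj ->.
- case/existsP => a /existsP[i /andP[/eqP-> /eqP->]].
  rewrite !f_path ?ltn_ord //; last exact: ltnW.
  have /(pathP (h (arc_tail a))) := arcsP _ _ (valP a).
  by rewrite size_rcons; apply; exact: ltn_ord.
Qed.

End Subdivisions.

(** * Finding the bioriented triangle minus an arc *)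

Section BiorientedTriangle.
Variables (D : digraph) (e : arc_of biK3).

Lemma ord3_third (a b : 'I_3) : a != b ->
  exists2 c, (c != a) && (c != b) & forall u, [|| u == a, u == b | u == c].
Proof.
move=> ab; have ab' : (a : nat) <> b by move/val_inj/eqP; apply/negP.
(* The three labels 0, 1 and 2 sum to 3. *)
have lt3 : 3 - a - b < 3 by move: (ltn_ord a) (ltn_ord b) ab'; lia.
exists (Ordinal lt3) => [|u]; rewrite -!val_eqE /=.
  by move: (ltn_ord a) (ltn_ord b) ab'; lia.
by move: (ltn_ord a) (ltn_ord b) (ltn_ord u) ab'; lia.
Qed.

(** If the deleted arc is [(a, b)] and [c] is the third vertex, then [v], [x], [y] play [c], [a],
    [b]. The two cycles through [v] give the digons at [c], and [r] gives the remaining arc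
    [(b, a)]. *)
Lemma two_cycles_subdivision (v x y : D) (p1 p2 q1 q2 r : seq D) :
  path (@is_arc D) v (rcons p1 x) -> path (@is_arc D) x (rcons p2 v) ->
  path (@is_arc D) v (rcons q1 y) -> path (@is_arc D) y (rcons q2 v) ->
  path (@is_arc D) y (rcons r x) ->
  uniq (v :: x :: y :: p1 ++ p2 ++ q1 ++ q2 ++ r) ->
  contains_subdivision D (del_arc e).
Proof.
move=> vx xv vy yv yx U.
have [a [b [def_e ab]]] : exists a b, val e = (a, b) /\ a != b.
  by have := valP e; case: (val e) => a b ab; exists a, b.
have [c /andP[ca cb] abc] := ord3_third ab.
pose h (u : 'I_3) := if u == a then x else if u == b then y else v.
pose P (u w : 'I_3) := if u == c then if w == a then p1 else q1
  else if w == c then if u == a then p2 else q2 else r.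
have [ha hb hc] : [/\ h a = x, h b = y & h c = v].
  by rewrite /h !eqxx (negbTE ca) (negbTE cb) eq_sym (negbTE ab).
have cE (z : D) s : (z \in s) = (0 < count_mem z s).
  by rewrite -has_count has_pred1.
(* Counting occurrences turns all distinctness and disjointness conditions into linear
   arithmetic. *)
have cnt z : (v == z) + ((x == z) + ((y == z) + (count_mem z p1 +
    (count_mem z p2 + (count_mem z q1 + (count_mem z q2 + count_mem z r)))))) <= 1.
  by have := count_uniq_mem z U; rewrite /= !count_cat => ->; case: (_ \in _).
have [neqvx neqvy neqxy] : [/\ v != x, v != y & x != y].
  split; apply/negP => /eqP E; have := cnt x; have := cnt y;
    rewrite ?E !eqxx; clear; lia.
have arcP u w : is_arc (u : del_arc e) w ->
    [\/ u = c /\ w = a, u = a /\ w = c, u = c /\ w = b | u = b /\ w = c] \/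
    u = b /\ w = a.
  rewrite /= /del_arc_rel def_e /= xpair_eqE.
  case/or3P: (abc u) => /eqP->; case/or3P: (abc w) => /eqP->;
    rewrite ?eqxx ?andbF //= => _.
  - by left; constructor 2.
  - by right.
  - by left; constructor 4.
  - by left; constructor 1.
  - by left; constructor 3.
have [Pca Pac Pcb Pbc Pba] :
    [/\ P c a = p1, P a c = p2, P c b = q1, P b c = q2 & P b a = r].
  rewrite /P !eqxx ![_ == c]eq_sym (negbTE ca) (negbTE cb).
  by rewrite ![b == a]eq_sym (negbTE ab).
apply: (@path_system_subdivision D (del_arc e) h P).
- move=> u w; case/or3P: (abc u) => /eqP->; case/or3P: (abc w) => /eqP->;
    rewrite ?ha ?hb ?hc // => E; move: neqvx neqvy neqxy; by rewrite E eqxx.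
- by move=> u w /arcP[[]|] [-> ->]; rewrite ?ha ?hb ?hc ?Pca ?Pac ?Pcb ?Pbc ?Pba.
- have [? ? ? ? ?] : [/\ uniq p1, uniq p2, uniq q1, uniq q2 & uniq r].
    have:= U; rewrite /= !cat_uniq => /and4P[_ _ _].
    by case/and3P=> -> _ /and3P[-> _ /and3P[-> _ /and3P[-> _ ->]]].
  by move=> u w /arcP[[]|] [-> ->]; rewrite ?Pca ?Pac ?Pcb ?Pbc ?Pba.
- move=> u w t /arcP[[]|] [-> ->]; rewrite ?Pca ?Pac ?Pcb ?Pbc ?Pba cE;
    have := cnt (h t); case/or3P: (abc t) => /eqP->;
    rewrite ?ha ?hb ?hc eqxx; clear; lia.
- move=> u w u' w' z /arcP[[]|] [-> ->] /arcP[[]|] [-> ->] //;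
    rewrite ?Pca ?Pac ?Pcb ?Pbc ?Pba !cE; have := cnt z; clear; lia.
Qed.

Lemma forces_subdivision_del_biK3 :
  ~ two_colorable [set: D] -> contains_subdivision D (del_arc e).
Proof.
move=> /critical_set_exists[S crS].
have [v vS strSv] := critical_del_vertex_strong crS.
have [c hc] := crS.2 _ (properD1 vS).
have [p [vp up p0 pS cp]] := mono_cycle_through true crS.1 vS hc.
have [q [vq uq q0 qS cq]] := mono_cycle_through false crS.1 vS hc.
have [x0 x0p] : exists x, x \in p by case: (p) p0 => // x ? _; exists x; exact: mem_head.
have [y0 y0q] : exists y, y \in q by case: (q) q0 => // y ? _; exists y; exact: mem_head.
(* The two cycles have different colors away from [v]. *)
have dpq : [disjoint [set z in p] & [set z in q]].
  apply/pred0P => z /=; rewrite !inE; apply/negP => /andP[/cp cz /cq].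
  by rewrite cz.
have /connectP[r0 yr0 def_x0] := strongP _ strSv y0 x0 (qS _ y0q) (pS _ x0p).
have [||y [x [r [+ + yr ur rpq]]]] := linking_path dpq _ yr0.
- by rewrite inE.
- by rewrite -def_x0 inE.
rewrite !inE => yq xp; have [{}yr rS] := path_within yr.
case/splitPr: xp => p1 p2 in vp up pS dpq rpq *.
case/splitPr: yq => q1 q2 in vq uq qS dpq rpq *.
move: vp vq; rewrite !rcons_cat !cat_path /= => /and3P[vp1 p1x xp2] /and3P[vq1 q1y yq2].
apply: (@two_cycles_subdivision v x y p1 p2 q1 q2 r) => //.
- by rewrite rcons_path vp1.
- by rewrite rcons_path vq1.
have perm : perm_eq (v :: x :: y :: p1 ++ p2 ++ q1 ++ q2 ++ r)
    (v :: ((p1 ++ x :: p2) ++ (q1 ++ y :: q2) ++ r)).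
  by apply/permP => t; rewrite /= !count_cat /=; clear; lia.
(* The linking path was taken inside [S :\ v]. *)
have vNr : v \notin r.
  apply/negP => vr; have := rS v.
  by rewrite mem_rcons inE vr orbT in_setD1 eqxx => /(_ isT).
rewrite (perm_uniq perm); move: up uq; rewrite ![uniq (v :: _)]/= => /andP[vNp up] /andP[vNq uq].
rewrite mem_cat (negbTE vNp) mem_cat (negbTE vNq) (negbTE vNr) /=.
rewrite cat_uniq up cat_uniq uq ur !andbT /= has_cat negb_or -andbA.
apply/and3P; split.
- apply/hasPn => z zq; have := disjointFl dpq (_ : z \in [set z in q1 ++ y :: q2]).
  by rewrite !inE => ->.
- by apply/hasPn => z /rpq; rewrite !inE => /andP[].
- by apply/hasPn => z /rpq; rewrite !inE => /andP[].
Qed.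

End BiorientedTriangle.

(** * The dichromatic number, and the digon as lower bound *)

Lemma two_colorable_acyclic_colorable (D : digraph) :
  two_colorable [set: D] -> acyclic_colorable D 2.
Proof.
case=> c hc; exists (fun x => if c x then ord0 else ord_max) => i [s [s0 cs sub]].
apply: (hc (i == ord0) s); split=> // x; first by rewrite inE.
by move/sub; rewrite inE => /eqP <-; case: (c x).
Qed.

Fact digon_irrefl : irreflexive (fun u v : bool => u != v).
Proof. by move=> u; rewrite eqxx. Qed.

Fact digon_gt0 : 0 < #|{: bool}|.
Proof. by rewrite card_bool. Qed.

Definition digon := Digraph digon_irrefl digon_gt0.

Lemma dichromatic_number_digon : 2 <= dichromatic_number digon.
Proof.
(* With no colors a vertex has no image; with one color the digon is itself a monochromatic
   cycle. *)
rewrite /dichromatic_number; case: ex_minnP => [[|[|//]]] /asboolP[c hc] _.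
  by case: (c true).
case: (hc ord0); exists [:: true; false]; split=> // x _.
by rewrite inE; case: (c x) => [[|//] ?]; apply/eqP/val_inj.
Qed.

(** The branch vertices alone give the bound, which rules out the digon as host of a digraph on
    three vertices. *)
Lemma contains_subdivision_card (D F : digraph) :
  contains_subdivision D F -> #|F| <= #|D|.
Proof.
case=> l [H [f [/bij_eq_card eq_card _]]].
have : #|digraph_of H| <= #|D| by rewrite card_sig max_card.
by rewrite eq_card card_sum; apply: leq_trans; rewrite leq_addr.
Qed.

Theorem proposition10 (e : arc_of biK3) : is_mader (del_arc e) 3.
Proof.
split=> // [D chi_D|j j_gt0 forces_j].
  apply: forces_subdivision_del_biK3 => /two_colorable_acyclic_colorable col2.
  move: chi_D; rewrite /dichromatic_number; case: ex_minnP => k _ min_k.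
  by rewrite leqNgt ltnS min_k //; apply/asboolP.
rewrite leqNgt ltnS; apply/negP => j_le2.
have := contains_subdivision_card (forces_j _ (leq_trans j_le2 dichromatic_number_digon)).
by rewrite card_bool card_ord.
Qed.
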